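(* Let $\mathcal{C}$ be an idempotent-complete category, let $R,S,T$ be monads on $\mathcal{C}$, let $\lambda \colon TS \Rightarrow ST$ and $\sigma \colon SR \Rightarrow RS$ be weak distributive laws, and let $\tau \colon TR \Rightarrow RT$ be a distributive law, satisfying the Yang–Baxter equation $\sigma T \circ S\tau \circ \lambda R = R\lambda \circ \tau S \circ T\sigma$. Let $S\bullet_\lambda T$ be the weak composite monad of $\lambda$, with underlying functor $K$ and splitting maps $\pi^\lambda \colon ST \Rightarrow K$, $\iota^\lambda \colon K \Rightarrow ST$. Then $$\psi \triangleq R\pi^\lambda \circ \sigma T \circ S\tau \circ \iota^\lambda R \colon KR \Rightarrow RK$$ is a weak distributive law from the monad $S\bullet_\lambda T$ over the monad $R$ (i.e. of type $[R, S\bullet_\lambda T]$). If, additionally, $\sigma$ is a distributive law, then $\psi$ is a distributive law.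
   Context: $\mathcal{C}$ is idempotent complete: every idempotent morphism (hence every idempotent natural transformation between endofunctors) splits. A monad is $(T,\eta^T,\mu^T)$. For endofunctors $A,B$, $[A,B]$ denotes the type of natural transformations $BA \Rightarrow AB$. For monads $A,B$, a natural transformation $\lambda \colon BA \Rightarrow AB$ is a distributive law if it satisfies $(\eta^+)$ $\lambda \circ B\eta^A = \eta^A B$, $(\mu^+)$ $\lambda \circ B\mu^A = \mu^A B \circ A\lambda \circ \lambda A$, $(\eta^-)$ $\lambda \circ \eta^B A = A\eta^B$, $(\mu^-)$ $\lambda \circ \mu^B A = A\mu^B \circ \lambda B \circ B\lambda$; it is a weak distributive law if it satisfies $(\eta^+)$, $(\mu^+)$, $(\mu^-)$. For a weak distributive law $\lambda \colon TS \Rightarrow ST$, the idempotent $\kappa^\lambda \triangleq S\mu^T \circ \lambda T \circ \eta^T ST \colon ST \Rightarrow ST$ splits as $\kappa^\lambda = \iota^\lambda \circ \pi^\lambda$ with $\pi^\lambda \circ \iota^\lambda = 1_K$; the weak composite monad is $S\bullet_\lambda T \triangleq (K,\ \pi^\lambda \circ \eta^S\eta^T,\ \pi^\lambda \circ \mu^S\mu^T \circ S\lambda T \circ \iota^\lambda\iota^\lambda)$. *)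

(* Defs.v *)
From Stdlib Require Import IndefiniteDescription.

Set Implicit Arguments.
Unset Strict Implicit.
Unset Printing Implicit Defensive.

Record Category : Type := {
  Ob :> Type;
  Hom : Ob -> Ob -> Type;
  idm : forall X, Hom X X;
  cmp : forall X Y Z, Hom Y Z -> Hom X Y -> Hom X Z;
  cmp_id_l : forall X Y (f : Hom X Y), cmp (idm Y) f = f;
  cmp_id_r : forall X Y (f : Hom X Y), cmp f (idm X) = f;
  cmp_assoc : forall W X Y Z (h : Hom Y Z) (g : Hom X Y) (f : Hom W X),
    cmp h (cmp g f) = cmp (cmp h g) f
}.

Arguments Hom {c} _ _.
Arguments idm {c} _.
Arguments cmp {c X Y Z} _ _.
Arguments cmp_id_l {c X Y} _.
Arguments cmp_id_r {c X Y} _.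
Arguments cmp_assoc {c W X Y Z} _ _ _.

Declare Scope hom_scope.
Delimit Scope hom_scope with hom.
Notation "g ○ f" := (cmp g f) (at level 40, left associativity) : hom_scope.
Open Scope hom_scope.

Definition idempotent_complete (C : Category) : Prop :=
  forall (X : C) (e : Hom X X), e ○ e = e ->
  exists (Y : C) (p : Hom X Y) (i : Hom Y X), p ○ i = idm Y /\ i ○ p = e.

(* The action of an endofunctor is kept apart from its laws: since the record
   is primitive, composition of actions is associative and unital up to
   conversion, so that natural transformations between iterated composites can
   be composed without explicit associators and unitors. *)
Set Primitive Projections.
Record FunctorData (C : Category) : Type := {
  fobj :> C -> C;
  fmap : forall X Y : C, Hom X Y -> Hom (fobj X) (fobj Y)
}.
Unset Primitive Projections.

Arguments fmap {C} _ {X Y} _.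

Record Endofunctor (C : Category) : Type := {
  fdata :> FunctorData C;
  fmap_id : forall X : C, fmap fdata (idm X) = idm (fdata X);
  fmap_cmp : forall (X Y Z : C) (g : Hom Y Z) (f : Hom X Y),
    fmap fdata (g ○ f) = fmap fdata g ○ fmap fdata f
}.

Section Functors.
Variable C : Category.

Definition fid_data : FunctorData C :=
  {| fobj := fun X => X; fmap := fun X Y f => f |}.

Definition fcomp_data (F G : FunctorData C) : FunctorData C :=
  {| fobj := fun X => F (G X); fmap := fun X Y f => fmap F (fmap G f) |}.

Lemma fcomp_id (F G : Endofunctor C) (X : C) :
  fmap (fcomp_data F G) (idm X) = idm (fcomp_data F G X).
Proof. simpl; now rewrite !fmap_id. Qed.

Lemma fcomp_cmp (F G : Endofunctor C) (X Y Z : C) (g : Hom Y Z) (f : Hom X Y) :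
  fmap (fcomp_data F G) (g ○ f) =
  fmap (fcomp_data F G) g ○ fmap (fcomp_data F G) f.
Proof. simpl; now rewrite !fmap_cmp. Qed.

Canonical fid : Endofunctor C :=
  {| fdata := fid_data; fmap_id := fun X => eq_refl;
     fmap_cmp := fun X Y Z g f => eq_refl |}.

Canonical fcomp (F G : Endofunctor C) : Endofunctor C :=
  {| fdata := fcomp_data F G; fmap_id := fcomp_id F G;
     fmap_cmp := fcomp_cmp F G |}.

End Functors.

Arguments fid_data {C}.
Arguments fid {C}.

Declare Scope nt_scope.
Delimit Scope nt_scope with nt.

Notation "'Id'" := fid_data.
Notation "F ⋅ G" := (fcomp_data F G) (at level 35, right associativity).

Record NatTrans (C : Category) (F G : FunctorData C) : Type := {
  nt :> forall X : C, Hom (F X) (G X);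
  nt_nat : forall (X Y : C) (f : Hom X Y), nt Y ○ fmap F f = fmap G f ○ nt X
}.

Notation "F ⇒ G" := (NatTrans F G) (at level 60, no associativity).

Section NatTransOps.
Variable C : Category.

Definition nt_eq (F G : FunctorData C) (a b : F ⇒ G) : Prop :=
  forall X, a X = b X.

Definition nt_id (F : FunctorData C) : F ⇒ F.
Proof.
exists (fun X => idm (F X)).
abstract (intros X Y f; now rewrite cmp_id_l, cmp_id_r).
Defined.

Definition vcomp (F G H : FunctorData C) (b : G ⇒ H) (a : F ⇒ G) : F ⇒ H.
Proof.
exists (fun X => b X ○ a X).
abstract (intros X Y f;
  now rewrite <- cmp_assoc, nt_nat, cmp_assoc, nt_nat, cmp_assoc).
Defined.

Definition whisker_l (F : Endofunctor C) (G H : FunctorData C) (a : G ⇒ H) :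
  F ⋅ G ⇒ F ⋅ H.
Proof.
exists (fun X => fmap F (a X)).
abstract (intros X Y f; simpl; now rewrite <- !fmap_cmp, nt_nat).
Defined.

Definition whisker_r (G H : FunctorData C) (a : G ⇒ H) (F : FunctorData C) :
  G ⋅ F ⇒ H ⋅ F.
Proof.
exists (fun X => a (F X)).
abstract (intros X Y f; simpl; now rewrite nt_nat).
Defined.

End NatTransOps.

Arguments nt_id {C} F.

Notation "a ≡ b" := (nt_eq a b) (at level 70, no associativity) : nt_scope.
Notation "b ∘ a" := (vcomp b a) (at level 45, left associativity) : nt_scope.
Notation "F ◁ a" := (whisker_l F a) (at level 38, right associativity) : nt_scope.
Notation "a ▷ F" := (whisker_r a F) (at level 37, left associativity) : nt_scope.
Open Scope nt_scope.

Definition hcomp (C : Category) (F : FunctorData C) (F' : Endofunctor C)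
    (G G' : FunctorData C) (a : F ⇒ F') (b : G ⇒ G') : F ⋅ G ⇒ F' ⋅ G' :=
  (F' ◁ b) ∘ (a ▷ G).

Notation "a ⊛ b" := (hcomp a b) (at level 39, right associativity) : nt_scope.

Record Monad (C : Category) : Type := {
  mfun :> Endofunctor C;
  eta : Id ⇒ mfun;
  mu : mfun ⋅ mfun ⇒ mfun;
  mu_eta_l : mu ∘ (eta ▷ mfun) ≡ nt_id mfun;
  mu_eta_r : mu ∘ (mfun ◁ eta) ≡ nt_id mfun;
  mu_mu : mu ∘ (mu ▷ mfun) ≡ mu ∘ (mfun ◁ mu)
}.

Arguments eta {C} m.
Arguments mu {C} m.

Notation "'[[' A ',' B ']]'" := (B ⋅ A ⇒ A ⋅ B) (at level 0).

Section Laws.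
Variables (C : Category) (A B : Monad C) (l : [[A, B]]).

Definition eta_plus : Prop := l ∘ (B ◁ eta A) ≡ eta A ▷ B.
Definition mu_plus : Prop :=
  l ∘ (B ◁ mu A) ≡ (mu A ▷ B) ∘ (A ◁ l) ∘ (l ▷ A).
Definition eta_minus : Prop := l ∘ (eta B ▷ A) ≡ A ◁ eta B.
Definition mu_minus : Prop :=
  l ∘ (mu B ▷ A) ≡ (A ◁ mu B) ∘ (l ▷ B) ∘ (B ◁ l).

Record distributive_law : Prop := {
  dl_eta_plus : eta_plus;
  dl_mu_plus : mu_plus;
  dl_eta_minus : eta_minus;
  dl_mu_minus : mu_minus
}.

Record weak_distributive_law : Prop := {
  wdl_eta_plus : eta_plus;
  wdl_mu_plus : mu_plus;
  wdl_mu_minus : mu_minus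
}.

End Laws.

Arguments distributive_law {C} A B l.
Arguments weak_distributive_law {C} A B l.

Record Splitting (C : Category) (F : FunctorData C) (e : F ⇒ F) : Type := {
  mid : Endofunctor C;
  proj : F ⇒ mid;
  incl : mid ⇒ F;
  proj_incl : proj ∘ incl ≡ nt_id mid;
  incl_proj : incl ∘ proj ≡ e
}.

Lemma idempotent_nt_splits (C : Category) (HC : idempotent_complete C)
    (F : Endofunctor C) (e : F ⇒ F) (He : e ∘ e ≡ e) : inhabited (Splitting e).
Proof.
assert (H : forall X, {Y : C & {p : Hom (F X) Y & {i : Hom Y (F X) |
    p ○ i = idm Y /\ i ○ p = e X}}}).
{ intro X.
  destruct (constructive_indefinite_description _ (HC _ _ (He X))) as [Y H1].
  destruct (constructive_indefinite_description _ H1) as [p H2].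
  destruct (constructive_indefinite_description _ H2) as [i H3].
  exists Y, p, i; exact H3. }
pose (k X := projT1 (H X)).
pose (p X := projT1 (projT2 (H X)) : Hom (F X) (k X)).
pose (i X := proj1_sig (projT2 (projT2 (H X))) : Hom (k X) (F X)).
assert (Hpi : forall X, p X ○ i X = idm (k X))
  by (intro X; exact (proj1 (proj2_sig (projT2 (projT2 (H X)))))).
assert (Hip : forall X, i X ○ p X = e X)
  by (intro X; exact (proj2 (proj2_sig (projT2 (projT2 (H X)))))).
clearbody p i.
assert (Hpe : forall X, p X ○ e X = p X)
  by (intro X; now rewrite <- Hip, cmp_assoc, Hpi, cmp_id_l).
assert (Hei : forall X, e X ○ i X = i X)
  by (intro X; now rewrite <- Hip, <- cmp_assoc, Hpi, cmp_id_r).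
pose (KD := {| fobj := k; fmap := fun X Y f => p Y ○ fmap F f ○ i X |}).
assert (K1 : forall X : C, fmap KD (idm X) = idm (KD X)).
{ intro X; simpl; now rewrite fmap_id, cmp_id_r. }
assert (K2 : forall (X Y Z : C) (g : Hom Y Z) (f : Hom X Y),
    fmap KD (g ○ f) = fmap KD g ○ fmap KD f).
{ intros X Y Z g f; simpl. rewrite fmap_cmp, <- !cmp_assoc.
  rewrite (cmp_assoc (i Y)), Hip, (cmp_assoc (e Y)), nt_nat.
  now rewrite <- (cmp_assoc _ (e X)), Hei. }
pose (K := {| fdata := KD; fmap_id := K1; fmap_cmp := K2 |}).
assert (Np : forall (X Y : C) (f : Hom X Y), p Y ○ fmap F f = fmap K f ○ p X).
{ intros X Y f; simpl.
  now rewrite <- cmp_assoc, Hip, <- cmp_assoc, <- nt_nat, cmp_assoc, Hpe. }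
assert (Ni : forall (X Y : C) (f : Hom X Y), i Y ○ fmap K f = fmap F f ○ i X).
{ intros X Y f; simpl.
  now rewrite !cmp_assoc, Hip, nt_nat, <- cmp_assoc, Hei. }
constructor.
exists K {| nt := p : forall X, Hom (F X) (K X); nt_nat := Np |}
  {| nt := i : forall X, Hom (K X) (F X); nt_nat := Ni |}.
- exact Hpi.
- exact Hip.
Qed.

Lemma cmp_ext (C : Category) (X Y : C) (g g' : Hom X Y) (E : g = g')
  (W : C) (f : Hom W X) : g ○ f = g' ○ f.
Proof. now rewrite E. Qed.

(* [rw E] rewrites with E up to associativity, keeping composites associated
   to the right. *)
Ltac rnorm :=
  simpl; rewrite ?fmap_cmp, ?fmap_id, ?cmp_id_l, ?cmp_id_r, <- ?cmp_assoc.
Ltac rw E :=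
  let H := fresh in let H' := fresh in
  pose proof E as H; simpl in H;
  rewrite ?fmap_cmp, ?fmap_id, ?cmp_id_l, ?cmp_id_r, <- ?cmp_assoc in H;
  pose proof (cmp_ext H) as H'; simpl in H';
  repeat setoid_rewrite <- cmp_assoc in H';
  repeat setoid_rewrite cmp_id_l in H';
  rnorm; first [rewrite H' | rewrite H]; clear H H'; rnorm.
Ltac rwF F E := rw (f_equal (fun f => fmap F f) E).

(* An associative multiplication m with a unit u that is only right unital
   becomes a monad on the image of the idempotent  m ∘ u F. *)
Section SkewMonad.
Variables (C : Category) (F : Endofunctor C) (u : Id ⇒ F) (m : F ⋅ F ⇒ F).
Hypothesis m_u_r : m ∘ (F ◁ u) ≡ nt_id F.
Hypothesis m_m : m ∘ (m ▷ F) ≡ m ∘ (F ◁ m).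
Variable e : F ⇒ F.
Hypothesis eE : e ≡ m ∘ (u ▷ F).

Lemma skew_e_u (X : C) : e X ○ u X = u X.
Proof. rw (eE X). rw (nt_nat u (u X)). rw (m_u_r X). reflexivity. Qed.

Lemma skew_e_m (X : C) : e X ○ m X = m X ○ e (F X).
Proof.
rw (eE X). rw (nt_nat u (m X)). rw (eq_sym (m_m X)).
rw (eE (F X)). reflexivity.
Qed.

Lemma skew_m_e (X : C) : m X ○ fmap F (e X) = m X.
Proof.
rwF F (eE X). rw (eq_sym (m_m X)). rw (m_u_r (F X)). reflexivity.
Qed.

Lemma skew_idem : e ∘ e ≡ e.
Proof.
intro X; simpl. transitivity (e X ○ (m X ○ u (F X))).
- now rewrite (eE X) at 2.
- rw (skew_e_m X). rw (skew_e_u (F X)). rw (eE X). reflexivity.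
Qed.

Variables (K : Endofunctor C) (p : F ⇒ K) (i : K ⇒ F).
Hypothesis skew_p_i : p ∘ i ≡ nt_id K.
Hypothesis skew_i_p : i ∘ p ≡ e.

Lemma skew_p_e (X : C) : p X ○ e X = p X.
Proof. rw (eq_sym (skew_i_p X)). rw (skew_p_i X). reflexivity. Qed.

Definition skew_eta : Id ⇒ K := p ∘ u.
Definition skew_mu : K ⋅ K ⇒ K := p ∘ m ∘ (i ⊛ i).

Lemma skew_eta_l : skew_mu ∘ (skew_eta ▷ K) ≡ nt_id K.
Proof.
intro X. rw (skew_i_p (K X)). rw (skew_e_u (K X)).
rw (eq_sym (nt_nat u (i X))). rw (eq_sym (eE X)). rw (skew_p_e X).
exact (skew_p_i X).
Qed.

Lemma skew_eta_r : skew_mu ∘ (K ◁ skew_eta) ≡ nt_id K.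
Proof.
intro X. rw (nt_nat i (p X)). rw (nt_nat i (u X)).
rwF F (skew_i_p X). rwF F (skew_e_u X). rw (m_u_r X).
exact (skew_p_i X).
Qed.

Lemma skew_assoc : skew_mu ∘ (skew_mu ▷ K) ≡ skew_mu ∘ (K ◁ skew_mu).
Proof.
intro X.
rw (skew_i_p (K X)). rw (skew_e_m (K X)).
rw (eq_sym (nt_nat m (i X))). rw (m_m X).
rw (eq_sym (nt_nat e (fmap F (i X)))).
rw (eq_sym (nt_nat e (m X))). rw (eq_sym (skew_e_m X)). rw (skew_p_e X).
symmetry.
rw (nt_nat i (p X)). rwF F (skew_i_p X). rw (skew_m_e X).
rw (nt_nat i (m X)). rw (nt_nat i (fmap F (i X))).
rw (nt_nat i (i (K X))).
reflexivity.
Qed.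

End SkewMonad.

Section WeakComposite.
Variables (C : Category) (S T : Monad C) (l : [[S, T]]).

Definition kappa : S ⋅ T ⇒ S ⋅ T :=
  (S ◁ mu T) ∘ (l ▷ T) ∘ (eta T ▷ (S ⋅ T)).

Hypothesis wl : weak_distributive_law S T l.

Let u : Id ⇒ S ⋅ T := eta S ⊛ eta T.
Let m : (S ⋅ T) ⋅ (S ⋅ T) ⇒ S ⋅ T := (mu S ⊛ mu T) ∘ (S ◁ l ▷ T).

Lemma wc_u_r : m ∘ ((S ⋅ T) ◁ u) ≡ nt_id (S ⋅ T).
Proof.
intro X.
rwF S (f_equal (fmap T) (eq_sym (nt_nat (eta S) (eta T X)))).
rwF S (wdl_eta_plus wl (T X)). rw (mu_eta_r S (T (T X))).
rwF S (mu_eta_r T X). reflexivity.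
Qed.

Lemma wc_assoc : m ∘ (m ▷ (S ⋅ T)) ≡ m ∘ ((S ⋅ T) ◁ m).
Proof.
intro X.
rwF S (wdl_mu_minus wl (T X)).
rw (nt_nat (mu S) (mu T (T X))).
rw (eq_sym (nt_nat (mu S) (fmap T (l (T X))))).
rw (eq_sym (nt_nat (mu S) (l (T (T X))))).
rwF S (mu_mu T X). rw (mu_mu S (T (T (T X)))).
symmetry.
rwF S (nt_nat l (mu T X)). rw (nt_nat (mu S) (fmap T (mu T X))).
rwF S (wdl_mu_plus wl (T (T X))).
rwF S (nt_nat l (l (T X))).
reflexivity.
Qed.

Lemma wc_kappa : kappa ≡ m ∘ (u ▷ (S ⋅ T)).
Proof.
intro X. symmetry.
rw (eq_sym (nt_nat (eta S) (eta T (S (T X))))).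
rw (eq_sym (nt_nat (eta S) (l (T X)))).
rw (mu_eta_l S (T (T X))). reflexivity.
Qed.

Lemma kappa_idem : kappa ∘ kappa ≡ kappa.
Proof. exact (skew_idem wc_u_r wc_assoc wc_kappa). Qed.

Variable s : Splitting kappa.

Definition weak_composite : Monad C :=
  {| mfun := mid s;
     eta := proj s ∘ (eta S ⊛ eta T);
     mu := proj s ∘ ((mu S ⊛ mu T) ∘ (S ◁ l ▷ T)) ∘ (incl s ⊛ incl s);
     mu_eta_l := skew_eta_l wc_u_r wc_kappa (proj_incl s) (incl_proj s);
     mu_eta_r := skew_eta_r wc_u_r wc_kappa (proj_incl s) (incl_proj s);
     mu_mu := skew_assoc wc_u_r wc_assoc wc_kappa (proj_incl s) (incl_proj s) |}.

End WeakComposite.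

(* Main.v *)
Require Import Defs.

(** Put [phi := σT ∘ Sτ : STR ⇒ RST], and let [u], [m] be the unit and the
    multiplication of the skew monad [ST] whose defective left unit law is
    repaired by splitting [κ]. By the Yang–Baxter equation, [phi] is compatible
    with [m] and with the monad [R], as for Beck's composite of distributive
    laws; it is compatible with [u] when [σ] is a distributive law. The
    Yang–Baxter equation and the unit law of [τ] with respect to [T] show
    moreover that [phi] commutes with [κ], that is [Rκ ∘ phi = phi ∘ κR], and a
    law that commutes with an idempotent restricts to its image. *)

Set Implicit Arguments.
Unset Strict Implicit.

Section RetractLaw.
Variables (C : Category) (R : Monad C) (F K : Endofunctor C).
Variables (e : F ⇒ F) (p : F ⇒ K) (i : K ⇒ F).
Hypothesis p_i : p ∘ i ≡ nt_id K.
Hypothesis i_p : i ∘ p ≡ e.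
Variable phi : F ⋅ R ⇒ R ⋅ F.
Variable psi : K ⋅ R ⇒ R ⋅ K.
(** Pointwise equality leaves the bracketing of the composite free. *)
Hypothesis psiE : psi ≡ (R ◁ p) ∘ phi ∘ (i ▷ R).

Lemma retract_law_eta_plus :
  phi ∘ (F ◁ eta R) ≡ eta R ▷ F ->
  psi ∘ (K ◁ eta R) ≡ eta R ▷ K.
Proof.
intros H X. rw (psiE X). rw (nt_nat i (eta R X)). rw (H X).
rw (eq_sym (nt_nat (eta R) (p X))). rw (p_i X). reflexivity.
Qed.

Hypothesis phi_e : phi ∘ (e ▷ R) ≡ (R ◁ e) ∘ phi.

Lemma retract_p_e (X : C) : p X ○ e X = p X.
Proof. rw (eq_sym (i_p X)). rw (p_i X). reflexivity. Qed.

Lemma retract_e_i (X : C) : e X ○ i X = i X.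
Proof. rw (eq_sym (i_p X)). rw (p_i X). reflexivity. Qed.

Lemma retract_law_mu_plus :
  phi ∘ (F ◁ mu R) ≡ (mu R ▷ F) ∘ (R ◁ phi) ∘ (phi ▷ R) ->
  psi ∘ (K ◁ mu R) ≡ (mu R ▷ K) ∘ (R ◁ psi) ∘ (psi ▷ R).
Proof.
intros H X. rw (psiE X). rw (nt_nat i (mu R X)). rw (H X).
rw (eq_sym (nt_nat (mu R) (p X))).
symmetry.
rwF R (psiE X). rw (psiE (R X)).
rwF R (i_p (R X)). rwF R (phi_e X).
rwF R (f_equal (fmap R) (retract_p_e X)). reflexivity.
Qed.

Lemma retract_law_eta_minus (u : Id ⇒ F) :
  e ∘ u ≡ u ->
  phi ∘ (u ▷ R) ≡ R ◁ u ->
  psi ∘ ((p ∘ u) ▷ R) ≡ R ◁ (p ∘ u).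
Proof.
intros Hu H X. rw (psiE X). rw (i_p (R X)). rw (Hu (R X)). rw (H X). reflexivity.
Qed.

Lemma retract_law_mu_minus (m : F ⋅ F ⇒ F) :
  phi ∘ (m ▷ R) ≡ (R ◁ m) ∘ (phi ▷ F) ∘ (F ◁ phi) ->
  psi ∘ ((p ∘ m ∘ (i ⊛ i)) ▷ R)
  ≡ (R ◁ (p ∘ m ∘ (i ⊛ i))) ∘ (psi ▷ K) ∘ (K ◁ psi).
Proof.
intros H X.
rw (psiE X). rw (i_p (R X)). rw (phi_e X). rwF R (retract_p_e X). rw (H X).
symmetry.
rw (psiE (K X)). rwF K (psiE X).
(* Here each of the two factors [i ∘ p = e] moves right through [phi] and is absorbed by [i]. *)
rwF R (i_p (K X)). rw (eq_sym (phi_e (K X))). rw (retract_e_i (R (K X))).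
rw (eq_sym (nt_nat phi (i X))). rw (nt_nat i (fmap R (p X))).
rw (nt_nat i (phi X)). rw (nt_nat i (i (R X))).
rwF F (f_equal (fmap R) (i_p X)).
rwF F (eq_sym (phi_e X)). rwF F (retract_e_i (R X)). reflexivity.
Qed.

End RetractLaw.

Section CompositeLaw.
Variables (C : Category) (R S T : Monad C).
Variables (lambda : [[S, T]]) (sigma : [[R, S]]) (tau : [[R, T]]).

Definition composite_law : (S ⋅ T) ⋅ R ⇒ R ⋅ (S ⋅ T) :=
  (sigma ▷ T) ∘ (S ◁ tau).

Lemma composite_law_eta_plus :
  eta_plus sigma -> eta_plus tau ->
  composite_law ∘ ((S ⋅ T) ◁ eta R) ≡ eta R ▷ (S ⋅ T).
Proof.
intros Hs Ht X. rwF S (Ht X). rw (Hs (T X)). reflexivity.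
Qed.

Lemma composite_law_mu_plus :
  mu_plus sigma -> mu_plus tau ->
  composite_law ∘ ((S ⋅ T) ◁ mu R)
  ≡ (mu R ▷ (S ⋅ T)) ∘ (R ◁ composite_law) ∘ (composite_law ▷ R).
Proof.
intros Hs Ht X. rwF S (Ht X). rw (Hs (T X)).
rw (nt_nat sigma (tau X)). reflexivity.
Qed.

Lemma composite_law_eta_minus :
  eta_minus sigma -> eta_minus tau ->
  composite_law ∘ ((eta S ⊛ eta T) ▷ R) ≡ R ◁ (eta S ⊛ eta T).
Proof.
intros Hs Ht X. rwF S (Ht X). rw (nt_nat sigma (eta T X)).
rw (Hs X). reflexivity.
Qed.

Hypothesis Yang_Baxter :
  (sigma ▷ T) ∘ (S ◁ tau) ∘ (lambda ▷ R)
  ≡ (R ◁ lambda) ∘ (tau ▷ S) ∘ (T ◁ sigma).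

Lemma composite_law_mu_minus :
  mu_minus sigma -> mu_minus tau ->
  composite_law ∘ (((mu S ⊛ mu T) ∘ (S ◁ lambda ▷ T)) ▷ R)
  ≡ (R ◁ ((mu S ⊛ mu T) ∘ (S ◁ lambda ▷ T)))
    ∘ (composite_law ▷ (S ⋅ T)) ∘ ((S ⋅ T) ◁ composite_law).
Proof.
intros Hs Ht X. rwF S (Ht X).
rw (nt_nat sigma (mu T X)).
rw (eq_sym (nt_nat (mu S) (fmap T (tau X)))).
rw (eq_sym (nt_nat (mu S) (tau (T X)))).
rw (Hs (T (T X))).
(* Once [tau X] has slid past [lambda], the left side of the Yang-Baxter equation appears under
   [S]. *)
rwF S (eq_sym (nt_nat lambda (tau X))).
rwF S (Yang_Baxter (T X)).
rw (nt_nat sigma (lambda (T X))). reflexivity.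
Qed.

(** The three factors of [kappa] pass [R] one by one: [mu T] by [mu_minus tau], [lambda] by
    Yang-Baxter, [eta T] by [eta_minus tau]. *)
Lemma composite_law_kappa :
  eta_minus tau -> mu_minus tau ->
  composite_law ∘ (kappa lambda ▷ R) ≡ (R ◁ kappa lambda) ∘ composite_law.
Proof.
intros He Hm X. rwF S (Hm X). rw (nt_nat sigma (mu T X)).
rw (eq_sym (nt_nat lambda (tau X))).
rw (Yang_Baxter (T X)).
rw (eq_sym (nt_nat (eta T) (fmap S (tau X)))).
rw (eq_sym (nt_nat (eta T) (sigma (T X)))).
rw (He (S (T X))). reflexivity.
Qed.

End CompositeLaw.

Theorem theorem4p5 (C : Category) (HC : idempotent_complete C)
  (R S T : Monad C)
  (lambda : [[S, T]]) (sigma : [[R, S]]) (tau : [[R, T]])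
  (Hlambda : weak_distributive_law S T lambda)
  (Hsigma : weak_distributive_law R S sigma)
  (Htau : distributive_law R T tau)
  (Yang_Baxter :
     (sigma ▷ T) ∘ (S ◁ tau) ∘ (lambda ▷ R)
     ≡ (R ◁ lambda) ∘ (tau ▷ S) ∘ (T ◁ sigma))
  (s : Splitting (kappa lambda)) :
  let ST := weak_composite Hlambda s in
  let psi : [[R, ST]] :=
    (R ◁ proj s) ∘ (sigma ▷ T) ∘ (S ◁ tau) ∘ (incl s ▷ R) in
  weak_distributive_law R ST psi /\
  (distributive_law R S sigma -> distributive_law R ST psi).
Proof.
intros ST psi.
pose proof (dl_eta_minus Htau) as tau_eta_minus.
pose proof (dl_mu_minus Htau) as tau_mu_minus.
pose proof (composite_law_kappa Yang_Baxter tau_eta_minus tau_mu_minus) as phi_e.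
assert (psiE : psi ≡ (R ◁ proj s) ∘ composite_law sigma tau ∘ (incl s ▷ R))
  by (intro X; rnorm; reflexivity).
assert (Hpsi : weak_distributive_law R ST psi).
{ constructor.
  - exact (retract_law_eta_plus (proj_incl s) psiE
      (composite_law_eta_plus (wdl_eta_plus Hsigma) (dl_eta_plus Htau))).
  - exact (retract_law_mu_plus (proj_incl s) (incl_proj s) psiE phi_e
      (composite_law_mu_plus (wdl_mu_plus Hsigma) (dl_mu_plus Htau))).
  (* The multiplication of [ST] is by definition of the form [p ∘ m ∘ (i ⊛ i)]. *)
  - exact (retract_law_mu_minus (proj_incl s) (incl_proj s) psiE phi_e
      (composite_law_mu_minus Yang_Baxter (wdl_mu_minus Hsigma) tau_mu_minus)). }
split; [exact Hpsi | intro Dsigma].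
constructor; [apply Hpsi | apply Hpsi | | apply Hpsi].
(* [kappa lambda] fixes [eta S ⊛ eta T], so the unit law of [composite_law] descends to the
   image. *)
exact (retract_law_eta_minus (incl_proj s) psiE
  (skew_e_u (wc_u_r Hlambda) (wc_kappa lambda))
  (composite_law_eta_minus (dl_eta_minus Dsigma) tau_eta_minus)).
Qed.
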